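(* Assume that the problem has no bound constraints, i.e. consider minimizing $f+h$ over $\mathbb R^n$. Consider a run of the trust-region algorithm described in the context, with its stopping test ignored, and with $\nu_k=\alpha\Delta_k/(1+\|B_k\|(1+\alpha\Delta_k))$ at every iteration. Assume that: (i) there is $\kappa_{\mathrm{mdc}}\in(0,1)$ such that $m(0;x_k,B_k)-m(s_k;x_k,B_k)\ge\kappa_{\mathrm{mdc}}\,\xi_{\mathrm{cp}}(\Delta_k;x_k,\nu_k)$ for all $k$; (ii) there is $\kappa_{\mathrm{ubd}}>0$ such that $|(f+h)(x_k+s_k)-m(s_k;x_k,B_k)|\le\kappa_{\mathrm{ubd}}(1+\|B_k\|)\|s_k\|^2$ for all $k$; (iii) there are $\mu>0$ and $0<p<1$ such that $\max_{0\le j\le k}\|B_j\|\le\mu(1+\sigma_k^p)$ for all $k\in\mathbb N$; (iv) infinitely many iterations are successful, and $\mu+1\le\mu|S(\epsilon)|^p$ for all sufficiently small $\epsilon\in(0,1)$; (v) $(f+h)(x_k)$ is bounded below over $k\in\mathbb N$. Let $N\subseteq\mathbb N$ be an infinite index set such that $\{\nu_k^{-1/2}\xi_{\mathrm{cp}}(\Delta_k;x_k,\nu_k)^{1/2}\}_{k\in N}\to0$, $\{\nu_k^{-1}s_{k,1}\}_{k\in N}\to0$, $\{s_{k,1}\}_{k\in N}\to0$ and $\{s_k\}_{k\in N}\to0$. Let $N_1\subseteq N$ be infinite with $\{\nu_k\}_{k\in N_1}\to\bar\nu>0$, and let $\{x_k\}_{k\in N_1}\to\bar x$. Assume that the upper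 epi-limit $$\overline\psi:=\operatorname{e-limsup}_{k\in N_1}\psi(\cdot;x_k)$$ is not identically $+\infty$, is proper lsc, and satisfies $\overline\psi(0)=h(\bar x)$ and $\partial\overline\psi(0)\subseteq\partial h(\bar x)$. If $\{\psi(s_{k,1};x_k)\}_{k\in N_1}\to\overline\psi(0)$, then $\bar x$ is stationary for the problem of minimizing $f+h$, i.e. $0\in\nabla f(\bar x)+\partial h(\bar x)$.
   Context: Norms and notation: $\|\cdot\|$ is the Euclidean norm on $\mathbb R^n$ and the induced spectral norm on matrices; $\overline{\mathbb R}=\mathbb R\cup\{\pm\infty\}$. Problem: minimize $f(x)+h(x)$ over $x\in\mathbb R^n$, where $f:\mathbb R^n\to\mathbb R$ is continuously differentiable and $h:\mathbb R^n\to\mathbb R\cup\{+\infty\}$ is proper and lower semicontinuous (lsc). Both may be nonconvex. Subdifferential: for $\phi:\mathbb R^n\to\overline{\mathbb R}$ finite at $\bar x$, $\widehat\partial\phi(\bar x)$ is the set of $v$ with $\liminf_{x\to\bar x,x\ne\bar x}\frac{\phi(x)-\phi(\bar x)-v^T(x-\bar x)}{\|x-\bar x\|}\ge0$; $\partial\phi(\bar x)$ is the set of $v$ for which there are $x_k\to\bar x$, $v_k\to v$ with $\phi(x_k)\to\phi(\bar x)$ and $v_k\in\widehat\partial\phi(x_k)$. Upper epi-limit: $\operatorname{epi}\phi=\{(t,x)\mid t\ge\phi(x)\}\subseteq\mathbb R\times\mathbb R^n$. For sets $A_k$, $\liminf_kA_k$ is the set of limits of sequences $\{y_k\}$ with $y_k\in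 A_k$ for all large $k$. $\operatorname{e-limsup}_k\phi_k$ is the function whose epigraph is $\liminf_k\operatorname{epi}\phi_k$; equivalently $(\operatorname{e-limsup}_k\phi_k)(x)=\min\{a\in\overline{\mathbb R}\mid\exists\,y_k\to x,\ \limsup_k\phi_k(y_k)=a\}$. Models: for every $x$ where $h$ is finite, a model $\psi(\cdot;x):\mathbb R^n\to\overline{\mathbb R}$ of $s\mapsto h(x+s)$ is given; it is assumed proper lsc with $\psi(0;x)=h(x)$ and $\partial\psi(0;x)\subseteq\partial h(x)$. Set $\varphi_{\mathrm{cp}}(s;x)=f(x)+\nabla f(x)^Ts$, $m_{\mathrm{cp}}(s;x,\nu)=\varphi_{\mathrm{cp}}(s;x)+\tfrac12\nu^{-1}\|s\|^2+\psi(s;x)$, and $m(s;x,B)=f(x)+\nabla f(x)^Ts+\tfrac12s^TBs+\psi(s;x)$ with $B=B^T$. Algorithm: constants $0<\eta_1\le\eta_2<1$, $0<1/\gamma_3\le\gamma_1\le\gamma_2<1<\gamma_3\le\gamma_4$, $\Delta_{\max}>\Delta_0>0$, $\alpha>0$, $\beta\ge1$, tolerance $\epsilon>0$, and $x_0$ with $h(x_0)$ finite. At iteration $k=0,1,\dots$, with a symmetric matrix $B_k$: (1) choose $0<\nu_k\le\frac{\alpha\Delta_k}{1+\|B_k\|(1+\alpha\Delta_k)}$; (2) compute $s_{k,1}\in\operatorname{argmin}_{\|s\|\le\Delta_k}m_{\mathrm{cp}}(s;x_k,\nu_k)$ and let $\xi_{\mathrm{cp}}(\Delta_k;x_k,\nu_k)=f(x_k)+h(x_k)-\varphi_{\mathrm{cp}}(s_{k,1};x_k)-\psi(s_{k,1};x_k)$;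 (3) stopping test: terminate if $\nu_k^{-1/2}\xi_{\mathrm{cp}}(\Delta_k;x_k,\nu_k)^{1/2}\le\epsilon$; (4) compute an approximate minimizer $s_k$ of $m(\cdot;x_k,B_k)$ subject to $\|s\|\le\min(\Delta_k,\beta\|s_{k,1}\|)$, meaning a feasible $s_k$ with $m(s_k;x_k,B_k)\le m(s_{k,1};x_k,B_k)$; (5) compute $\rho_k=\frac{(f+h)(x_k)-(f+h)(x_k+s_k)}{m(0;x_k,B_k)-m(s_k;x_k,B_k)}$; set $x_{k+1}=x_k+s_k$ if $\rho_k\ge\eta_1$ and $x_{k+1}=x_k$ otherwise; (6) choose $\bar\Delta_{k+1}\in[\gamma_3\Delta_k,\gamma_4\Delta_k]$ if $\rho_k\ge\eta_2$ (very successful), in $[\gamma_2\Delta_k,\Delta_k]$ if $\eta_1\le\rho_k<\eta_2$, in $[\gamma_1\Delta_k,\gamma_2\Delta_k]$ if $\rho_k<\eta_1$ (unsuccessful); set $\Delta_{k+1}=\min(\bar\Delta_{k+1},\Delta_{\max})$. Iteration $k$ is successful if $\rho_k\ge\eta_1$. $\sigma_k=|\{j=0,\dots,k\mid\rho_j\ge\eta_1\}|$. For $0<\epsilon<1$, $k_\epsilon$ is the first iteration with $\nu_k^{-1/2}\xi_{\mathrm{cp}}(\Delta_k;x_k,\nu_k)^{1/2}\le\epsilon$ ($k_\epsilon=\infty$ if there is none), and $S(\epsilon)=\{k=0,\dots,k_\epsilon-1\mid\rho_k\ge\eta_1\}$. *)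

(* Defs.v *)
From HB Require Import structures.
From mathcomp Require Import all_boot all_order all_algebra.
From mathcomp Require Import all_classical all_reals all_analysis.

Set Implicit Arguments.
Unset Strict Implicit.
Unset Printing Implicit Defensive.

Import Order.TTheory GRing.Theory Num.Theory.
Import numFieldNormedType.Exports.

Local Open Scope classical_set_scope.
Local Open Scope ring_scope.

(* The library norm on matrices is the max norm, hence the Euclidean norm and
   the induced operator norm below. The topology is the library's one, which
   all norms induce. *)
Section euclidean.
Context {R : realType} {n : nat}.

Definition dot (u v : 'cV[R]_n) : R := (u^T *m v) 0 0.

Definition enorm (u : 'cV[R]_n) : R := Num.sqrt (dot u u).

Definition specnorm (A : 'M[R]_n) : R :=
  sup [set enorm (A *m v) | v in [set v | enorm v <= 1]].

Definition grad (f : 'cV[R]_n -> R) (x : 'cV[R]_n) : 'cV[R]_n :=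
  \col_i ('D_(delta_mx i 0) f x).

Definition continuously_differentiable (f : 'cV[R]_n -> R) : Prop :=
  (forall x, differentiable f x) /\ continuous (grad f).

End euclidean.

Section variational.
Context {R : realType} {n : nat}.
Local Open Scope ereal_scope.

Definition proper_fun (phi : 'cV[R]_n -> \bar R) : Prop :=
  (exists x, phi x < +oo) /\ (forall x, -oo < phi x).

(* Both subdifferentials are empty at the points where phi is not finite. *)
Definition regular_subdiff (phi : 'cV[R]_n -> \bar R) (xbar : 'cV[R]_n) :
    set 'cV[R]_n :=
  [set v | phi xbar \is a fin_num /\
    0 <= limf_einf (fun x => (phi x - phi xbar - (dot v (x - xbar))%:E)
                               / (enorm (x - xbar))%:E) xbar^'].

Definition limiting_subdiff (phi : 'cV[R]_n -> \bar R) (xbar : 'cV[R]_n) :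
    set 'cV[R]_n :=
  [set v | phi xbar \is a fin_num /\
    exists (xs vs : nat -> 'cV[R]_n),
      [/\ xs @ \oo --> xbar, vs @ \oo --> v,
          phi \o xs @ \oo --> phi xbar
        & forall k, regular_subdiff phi (xs k) (vs k)]].

Definition epigraph (phi : 'cV[R]_n -> \bar R) : set (R * 'cV[R]_n) :=
  [set tx | phi tx.2 <= tx.1%:E].

(* Lower limit of the sets A k as k tends to infinity within the index set N. *)
Definition set_liminf {T : topologicalType} (N : set nat) (A : nat -> set T) :
    set T :=
  [set y | exists2 u : nat -> T,
      u @ within N \oo --> y & \forall k \near within N \oo, A k (u k)].

Definition is_upper_epi_limit (N : set nat) (phi_ : nat -> 'cV[R]_n -> \bar R)
    (phi : 'cV[R]_n -> \bar R) : Prop :=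
  epigraph phi = set_liminf N (fun k => epigraph (phi_ k)).

End variational.

Section models.
Context {R : realType} {n : nat}.
Variables (f : 'cV[R]_n -> R) (h : 'cV[R]_n -> \bar R).
(* psi x s is the model of h (x + s). *)
Variable psi : 'cV[R]_n -> 'cV[R]_n -> \bar R.
Local Open Scope ereal_scope.

Definition objective (x : 'cV[R]_n) : \bar R := (f x)%:E + h x.

Definition model_assumption : Prop :=
  forall x, h x \is a fin_num ->
    [/\ proper_fun (psi x), lower_semicontinuous (psi x), psi x 0%R = h x
      & limiting_subdiff (psi x) 0%R `<=` limiting_subdiff h x].

Definition phi_cp (x s : 'cV[R]_n) : R := (f x + dot (grad f x) s)%R.

Definition m_cp (x : 'cV[R]_n) (nu : R) (s : 'cV[R]_n) : \bar R :=
  (phi_cp x s + 2^-1 * nu^-1 * enorm s ^+ 2)%R%:E + psi x s.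

Definition m_quad (x : 'cV[R]_n) (B : 'M[R]_n) (s : 'cV[R]_n) : \bar R :=
  (f x + dot (grad f x) s + 2^-1 * dot s (B *m s))%R%:E + psi x s.

(* Decrease of the first-order model achieved by the step s1. *)
Definition xi_cp (x s1 : 'cV[R]_n) : \bar R :=
  objective x - (phi_cp x s1)%:E - psi x s1.

End models.

Record tr_constants (R : realType) := TRConstants {
  eta1 : R; eta2 : R;
  gamma1 : R; gamma2 : R; gamma3 : R; gamma4 : R;
  Delta_init : R; Delta_max : R;
  alpha : R; beta : R }.

Definition valid_constants (R : realType) (c : tr_constants R) : Prop :=
  [/\ 0 < eta1 c, eta1 c <= eta2 c & eta2 c < 1] /\
  [/\ 0 < (gamma3 c)^-1, (gamma3 c)^-1 <= gamma1 c, gamma1 c <= gamma2 c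
    & gamma2 c < 1] /\
  [/\ 1 < gamma3 c & gamma3 c <= gamma4 c] /\
  [/\ 0 < Delta_init c & Delta_init c < Delta_max c] /\
  [/\ 0 < alpha c & 1 <= beta c].

(* it_s1 is the first-order step s_{k,1}, it_s the step s_k. *)
Record tr_iterates (R : realType) (n : nat) := TRIterates {
  it_x : nat -> 'cV[R]_n;
  it_B : nat -> 'M[R]_n;
  it_Delta : nat -> R;
  it_nu : nat -> R;
  it_s1 : nat -> 'cV[R]_n;
  it_s : nat -> 'cV[R]_n;
  it_rho : nat -> \bar R }.

Section algorithm.
Context {R : realType} {n : nat}.
Variables (f : 'cV[R]_n -> R) (h : 'cV[R]_n -> \bar R).
Variable psi : 'cV[R]_n -> 'cV[R]_n -> \bar R.
Variables (c : tr_constants R) (it : tr_iterates R n).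

Local Notation x := (it_x it).
Local Notation B := (it_B it).
Local Notation Delta := (it_Delta it).
Local Notation nu := (it_nu it).
Local Notation s1 := (it_s1 it).
Local Notation s := (it_s it).
Local Notation rho := (it_rho it).

Definition nu_bound (k : nat) : R :=
  alpha c * Delta k / (1 + specnorm (B k) * (1 + alpha c * Delta k)).

Definition predicted_decrease (k : nat) : \bar R :=
  (m_quad f psi (x k) (B k) 0 - m_quad f psi (x k) (B k) (s k))%E.

Definition actual_decrease (k : nat) : \bar R :=
  (objective f h (x k) - objective f h (x k + s k))%E.

Definition successful (k : nat) : bool := ((eta1 c)%:E <= rho k)%E.

Definition very_successful (k : nat) : bool := ((eta2 c)%:E <= rho k)%E.

Definition radius_update (k : nat) (Dbar : R) : Prop :=
  [/\ very_successful k -> gamma3 c * Delta k <= Dbar <= gamma4 c * Delta k,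
      successful k && ~~ very_successful k ->
        gamma2 c * Delta k <= Dbar <= Delta k
    & ~~ successful k -> gamma1 c * Delta k <= Dbar <= gamma2 c * Delta k].

(* An infinite run of the algorithm, in which the stopping test is ignored.
   Since the run goes on after exact stationarity, the quotient defining rho k
   may be 0 / 0: nothing is then assumed about rho k. *)
Record trust_region_run : Prop := TrustRegionRun {
  run_x0 : h (x 0%N) \is a fin_num;
  run_Delta0 : Delta 0%N = Delta_init c;
  run_B : forall k, (B k)^T = B k;
  run_nu : forall k, 0 < nu k <= nu_bound k;
  run_s1_feasible : forall k, enorm (s1 k) <= Delta k;
  run_s1_argmin : forall k v, enorm v <= Delta k ->
    (m_cp f psi (x k) (nu k) (s1 k) <= m_cp f psi (x k) (nu k) v)%E;
  run_s_feasible : forall k,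
    enorm (s k) <= Num.min (Delta k) (beta c * enorm (s1 k));
  run_s_decrease : forall k,
    (m_quad f psi (x k) (B k) (s k) <= m_quad f psi (x k) (B k) (s1 k))%E;
  run_rho : forall k, predicted_decrease k != 0%E ->
    rho k = (actual_decrease k / predicted_decrease k)%E;
  run_x : forall k, x k.+1 = if successful k then x k + s k else x k;
  run_Delta : forall k, exists2 Dbar : R,
    radius_update k Dbar & Delta k.+1 = Num.min Dbar (Delta_max c) }.

Definition xi_at (k : nat) : \bar R := xi_cp f h psi (x k) (s1 k).

Definition criticality (k : nat) : \bar R :=
  (((Num.sqrt (nu k))^-1)%:E * sqrte (xi_at k))%E.

Definition sigma (k : nat) : nat := #|[set j : 'I_k.+1 | successful j]|%SET.

(* The infimum of the empty set is +oo. *)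
Definition k_eps (eps : R) : \bar R :=
  ereal_inf [set k%:R%:E | k in [set k : nat | (criticality k <= eps%:E)%E]].

Definition successful_before (eps : R) : set nat :=
  [set k | (k%:R%:E < k_eps eps)%E /\ successful k].

End algorithm.

(* Main.v *)
(* As nu_k tends to nubar > 0 along N1, the radii Delta_k stay above some
   delta > 0, so s_{k,1} minimizes the first-order model over a fixed ball.
   Comparing its value at s_{k,1} with the value along a recovery sequence for
   the upper epi-limit and passing to the limit gives, for |v| < delta,
     psibar v >= psibar 0 - grad f(xbar) . v - |v|^2 / (2 nubar),
   so that - grad f(xbar) is a regular subgradient of psibar at 0.
   The value psibar 0 = lim psi(s_{k,1}; x_k) is finite because the objective
   does not increase along the run. *)
Require Import Defs.
From HB Require Import structures.
From mathcomp Require Import all_boot all_order all_algebra.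
From mathcomp Require Import all_classical all_reals all_analysis.
From mathcomp Require Import lra.

Set Implicit Arguments.
Unset Strict Implicit.
Unset Printing Implicit Defensive.

Import Order.TTheory GRing.Theory Num.Theory.
Import numFieldNormedType.Exports.

Local Open Scope classical_set_scope.
Local Open Scope ring_scope.

(** * Euclidean norm, spectral norm and their limits *)

Section euclidean_norm.
Context {R : realType} {n : nat}.
Implicit Types u v : 'cV[R]_n.

Lemma dotE u v : dot u v = \sum_i u i 0 * v i 0.
Proof. by rewrite /dot mxE; apply: eq_bigr => i _; rewrite mxE. Qed.

Lemma dot0r u : dot u 0 = 0.
Proof. by rewrite /dot mulmx0 mxE. Qed.

Lemma dotNl u v : dot (- u) v = - dot u v.
Proof. by rewrite /dot linearN mulNmx mxE. Qed.

Lemma dot_self_ge0 u : 0 <= dot u u.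
Proof. by rewrite dotE sumr_ge0// => i _; rewrite -expr2 sqr_ge0. Qed.

Lemma enorm_ge0 u : 0 <= enorm u.
Proof. exact: sqrtr_ge0. Qed.

Lemma enorm0 : enorm (0 : 'cV[R]_n) = 0.
Proof. by rewrite /enorm dot0r sqrtr0. Qed.

Lemma enorm_eq0 u : (enorm u == 0) = (u == 0).
Proof.
apply/idP/eqP => [|->]; last by rewrite enorm0.
rewrite /enorm sqrtr_eq0 => u0.
have /eqP : dot u u = 0 by apply/eqP; rewrite eq_le u0 dot_self_ge0.
rewrite dotE psumr_eq0 => [/allP u_eq0|i _]; last by rewrite -expr2 sqr_ge0.
apply/matrixP => i j; rewrite ord1 mxE; apply/eqP.
by have := u_eq0 i (mem_index_enum i); rewrite /= -expr2 sqrf_eq0.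
Qed.

Lemma specnorm_ge0 (A : 'M[R]_n) : 0 <= specnorm A.
Proof.
rewrite /specnorm; set S := [set _ | _ in _].
(* [sup] takes the value 0 on a set without a supremum, so that case is immediate; otherwise the
   vector 0 contributes the value 0 to the set. *)
have [supS|/sup_out->//] := pselect (has_sup S).
apply: (ub_le_sup supS.2); exists 0; first by rewrite /= enorm0 ler01.
by rewrite mulmx0 enorm0.
Qed.

Lemma cvg_dot {T : Type} {F : set_system T} {FF : Filter F}
    (u v : T -> 'cV[R]_n) (a b : 'cV[R]_n) :
  u @ F --> a -> v @ F --> b -> dot (u x) (v x) @[x --> F] --> dot a b.
Proof.
move=> ua vb; under eq_fun do rewrite dotE; rewrite dotE.
apply: cvg_big => [|i _]; first exact: add_continuous.
have coord (w : T -> 'cV[R]_n) (l : 'cV[R]_n) :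
    w @ F --> l -> w x i 0 @[x --> F] --> l i 0.
  exact: (@continuous_cvg _ 'cV[R]_n R F _ w (fun M => M i 0) l
    (@coord_continuous R n 1 i 0 l)).
by apply: cvgM; exact: coord.
Qed.

Lemma cvg_enorm {T : Type} {F : set_system T} {FF : Filter F}
    (u : T -> 'cV[R]_n) (a : 'cV[R]_n) :
  u @ F --> a -> enorm (u x) @[x --> F] --> enorm a.
Proof.
move=> ua; exact: (@continuous_cvg _ R R F _ _ Num.sqrt _
  (@sqrt_continuous R (dot a a)) (cvg_dot ua ua)).
Qed.

End euclidean_norm.

(** * Regular and limiting subgradients *)

Section subdifferentials.
Context {R : realType} {n : nat}.
Implicit Types (phi : 'cV[R]_n -> \bar R) (x v : 'cV[R]_n).

(** Dividing the minorization by [enorm (y - x)] bounds the difference quotient below by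
    [- C * enorm (y - x)], which tends to 0. *)
Lemma quadratic_minorant_regular_subdiff phi x v (C delta : R) :
  phi x \is a fin_num -> 0 < delta ->
  (forall y, enorm (y - x) < delta ->
    (phi x + (dot v (y - x) - C * enorm (y - x) ^+ 2)%:E <= phi y)%E) ->
  regular_subdiff phi x v.
Proof.
move=> phix delta0 minor; split=> //.
rewrite limf_einfE; apply/lee_subgt0Pr => e e0; rewrite sub0e.
have sub_cvg : enorm (y - x) @[y --> x] --> (0 : R).
  rewrite -(@enorm0 R n); apply: cvg_enorm; first exact: nbhs_filter.
  exact: (iffRL (@subr_cvg0 R _ _ (nbhs x) _ id x) cvg_id).
have Csub_cvg : C * enorm (y - x) @[y --> x] --> (0 : R).
  by rewrite -(mulr0 C); apply: (@cvgM _ _ _ (nbhs_filter x)) => //;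
    exact: cvg_cst.
(* The lower limit is a supremum of infima over punctured neighbourhoods. On this one every quotient
   is at least [- e], and it is [+oo] where [phi y] is. *)
pose V := [set y | y != x /\ enorm (y - x) < delta /\ C * enorm (y - x) < e].
apply: (@le_trans _ _ (ereal_inf [set ((phi y - phi x - (dot v (y - x))%:E)
    / (enorm (y - x))%:E)%E | y in V])).
  apply: le_ereal_inf_tmp => _ [y [yx [ydelta yC]] <-].
  have y0 : 0 < enorm (y - x) by rewrite lt0r enorm_ge0 enorm_eq0 subr_eq0 yx.
  move: (minor y ydelta); rewrite inver gt_eqF// -[phi x]fineK//.
  move: (fine (phi x)) => p; case: (phi y) => [q| |] //=.
    rewrite -!EFinD -!EFinM !lee_fin => h; rewrite -[leLHS]/(- e) ler_pdivlMr//.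
    nra.
  by move=> _; rewrite !addye// gt0_mulye ?lte_fin ?invr_gt0// leey.
apply: ereal_sup_ubound; exists V => //.
have nearV : \forall y \near x,
    enorm (y - x) < delta /\ C * enorm (y - x) < e.
  near=> y; split; near: y;
    [exact: cvgr_lt sub_cvg _ _|exact: cvgr_lt Csub_cvg _ _].
by apply: filterS nearV => y.
Unshelve. all: by end_near. Qed.

Lemma regular_subdiff_limiting phi x :
  regular_subdiff phi x `<=` limiting_subdiff phi x.
Proof.
move=> v phiv; split; first exact: phiv.1.
exists (cst x), (cst v); split=> [| | |k]; last exact: phiv.
- by apply: cvg_cst.
- by apply: cvg_cst.
- exact: (@cvg_cst _ (phi x)).
Qed.

End subdifferentials.

(** An infinite index set meets every tail of the naturals. Properness of the filter is what lets
    weak inequalities pass to limits along [N]. *)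
Lemma within_infinite_proper (N : set nat) :
  infinite_set N -> ProperFilter (within N \oo).
Proof.
move=> Ninf; split; last exact: within_filter.
move=> [m _ mN]; apply: Ninf; apply: (@sub_finite_set _ _ `I_m);
  last exact: finite_II.
by move=> k Nk /=; rewrite ltnNge; apply/negP => mk; exact: (mN k mk Nk).
Qed.

(** * Finiteness and monotonicity of the objective along the run *)

Section monotonicity.
Context {R : realType} {n : nat}.
Variables (f : 'cV[R]_n -> R) (h : 'cV[R]_n -> \bar R).
Variable psi : 'cV[R]_n -> 'cV[R]_n -> \bar R.
Variables (c : tr_constants R) (it : tr_iterates R n).
Hypotheses (psi_model : model_assumption h psi)
  (run : trust_region_run f h psi c it).

Local Notation x := (it_x it).
Local Notation B := (it_B it).
Local Notation nu := (it_nu it).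
Local Notation s1 := (it_s1 it).
Local Notation s := (it_s it).

Lemma run_Delta_ge0 k : 0 <= it_Delta it k.
Proof. exact: le_trans (enorm_ge0 _) (run_s1_feasible run k). Qed.

Lemma run_nu_gt0 k : 0 < nu k.
Proof. by have /andP[] := run_nu run k. Qed.

Lemma m_cp_0 y t : h y \is a fin_num -> m_cp f psi y t 0 = objective f h y.
Proof.
move=> /psi_model[_ _ psi0 _]; rewrite /m_cp /phi_cp /objective psi0.
by rewrite dot0r enorm0 expr0n mulr0 !addr0.
Qed.

Lemma m_quad_0 y A : h y \is a fin_num -> m_quad f psi y A 0 = objective f h y.
Proof.
move=> /psi_model[_ _ psi0 _]; rewrite /m_quad /objective psi0.
by rewrite mulmx0 !dot0r mulr0 !addr0.
Qed.

(** The zero step lies in the trust region, and the first-order model equals the objective there. *)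
Lemma cp_step_le k : h (x k) \is a fin_num ->
  (m_cp f psi (x k) (nu k) (s1 k) <= objective f h (x k))%E.
Proof.
move=> hk; rewrite -(m_cp_0 (nu k) hk); apply: (run_s1_argmin run).
by rewrite enorm0 run_Delta_ge0.
Qed.

(** Properness of the model excludes [-oo]; comparison with the finite objective at [x k] excludes
    [+oo]. *)
Lemma psi_cp_step_fin_num k : h (x k) \is a fin_num ->
  psi (x k) (s1 k) \is a fin_num.
Proof.
move=> hk; have := cp_step_le hk; rewrite fin_numE.
have [[_ psi_gtNy] _ _ _] := psi_model hk.
rewrite /m_cp /objective -(fineK hk) gt_eqF//=.
by case: (psi (x k) (s1 k)).
Qed.

(** This is [cp_step_le] with the proximal term isolated. It makes [xi_at] nonnegative, and forces
    [s1 k] to vanish when [xi_at] does. *)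
Lemma xi_at_ge k : h (x k) \is a fin_num ->
  ((2^-1 * (nu k)^-1 * enorm (s1 k) ^+ 2)%:E <= xi_at f h psi it k)%E.
Proof.
move=> hk; have := cp_step_le hk; have := psi_cp_step_fin_num hk.
rewrite /xi_at /xi_cp /m_cp /objective.
case/EFin_fin_numP: hk => r ->; case/EFin_fin_numP=> q ->.
by rewrite -!EFinD !lee_fin => *; lra.
Qed.

Context {kappa_mdc kappa_ubd : R}.
Hypotheses (kappa_mdc_gt0 : (0 < kappa_mdc)%R) (eta1_gt0 : 0 < eta1 c)
  (model_decrease : forall k,
     (kappa_mdc%:E * xi_at f h psi it k <= predicted_decrease f psi it k)%E)
  (model_accuracy : forall k,
     (`| objective f h (x k + s k) - m_quad f psi (x k) (B k) (s k) |
      <= (kappa_ubd * (1 + specnorm (B k)) * enorm (s k) ^+ 2)%:E)%E).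

(* When the predicted decrease vanishes, [rho k] is unconstrained, but then
   both steps are zero. *)
Lemma run_step k : h (x k) \is a fin_num ->
  h (x k.+1) \is a fin_num /\
  (objective f h (x k.+1) <= objective f h (x k))%E.
Proof.
move=> hk; rewrite (run_x run); case: ifPn => // succ.
have xi_ge := xi_at_ge hk.
have nu0 := run_nu_gt0 k.
have xi_ge0 : (0 <= xi_at f h psi it k)%E.
  apply: le_trans xi_ge; rewrite lee_fin mulr_ge0 ?sqr_ge0//.
  by rewrite mulr_ge0 ?invr_ge0 ?(ltW nu0).
have pred_ge := model_decrease k.
have pred_ge0 : (0 <= predicted_decrease f psi it k)%E.
  by apply: le_trans pred_ge; rewrite mule_ge0// lee_fin ltW.
have [pred0|pred_neq0] := eqVneq (predicted_decrease f psi it k) 0%E.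
  have xi_le0 : (xi_at f h psi it k <= 0)%E.
    by move: pred_ge; rewrite pred0 pmule_rle0 ?lte_fin//.
  have s1_eq0 : enorm (s1 k) = 0.
    have := le_trans xi_ge xi_le0.
    rewrite lee_fin pmulr_rle0 ?mulr_gt0 ?invr_gt0// => s1_le0.
    by apply/eqP; rewrite -sqrf_eq0 eq_le s1_le0 sqr_ge0.
  have s_le0 : enorm (s k) <= 0.
    by have := run_s_feasible run k; rewrite s1_eq0 mulr0 le_min => /andP[].
  have /eqP-> : s k == 0 by rewrite -enorm_eq0 eq_le s_le0 enorm_ge0.
  by rewrite addr0.
have [[_ psi_gtNy] _ _ _] := psi_model hk.
have /EFin_fin_numP[q1 psi_s1] := psi_cp_step_fin_num hk.
have /EFin_fin_numP[q psi_s] : psi (x k) (s k) \is a fin_num.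
  have := run_s_decrease run k; rewrite fin_numE gt_eqF//= /m_quad psi_s1.
  by case: (psi (x k) (s k)).
(* An infinite value of [h] would make the model error infinite, against its finite bound. *)
have hs : h (x k + s k) \is a fin_num.
  have := model_accuracy k; rewrite /objective /m_quad psi_s.
  by case: (h (x k + s k)).
split=> //; move: pred_ge0 pred_neq0 succ (run_rho run).
rewrite /successful => pred_ge0 pred_neq0 succ /(_ k pred_neq0) rhoE.
move: pred_ge0 pred_neq0 succ; rewrite rhoE /predicted_decrease m_quad_0//.
rewrite /actual_decrease /m_quad /objective psi_s.
case/EFin_fin_numP: hk => r ->; case/EFin_fin_numP: hs => t ->.
rewrite -!EFinD; set a := (X in (X%:E / _)%E).
set b := (X in (_ / X%:E)%E); rewrite !lee_fin eqe => b_ge0 b_neq0.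
rewrite inver (negbTE b_neq0) -EFinM lee_fin => rho_ge.
(* The ratio is at least [eta1 c > 0] and the predicted decrease [b] is positive, so the actual
   decrease [a] is nonnegative. *)
have : 0 <= a / b by apply: le_trans rho_ge; exact: ltW.
by rewrite pmulr_lge0 ?subr_ge0// invr_gt0 lt0r b_neq0.
Qed.

Lemma run_objective k :
  h (x k) \is a fin_num /\ (objective f h (x k) <= objective f h (x 0%N))%E.
Proof.
elim: k => [|k [hk objk]]; first by split=> //; exact: run_x0 run.
by have [hk1 objk1] := run_step hk; split=> //; exact: le_trans objk1 objk.
Qed.

End monotonicity.

(** * Stationarity of the limit point *)

Lemma cvg_within_subset {U : nbhsType} (u : nat -> U) (l : set_system U)
    (N N1 : set nat) :
  N1 `<=` N -> u @ within N \oo --> l -> u @ within N1 \oo --> l.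
Proof.
move=> sub ul A /ul[m mT mA]; exists m => // k mk N1k; exact: mA mk (sub k N1k).
Qed.

(** The denominator of [nu_bound] is at least 1. Read backwards, a lower bound on the step parameter
    gives one on the radius. *)
Lemma nu_bound_le {R : realType} {n : nat} (c : tr_constants R)
    (it : tr_iterates R n) (k : nat) :
  0 < alpha c -> 0 <= it_Delta it k ->
  nu_bound c it k <= alpha c * it_Delta it k.
Proof.
move=> alpha0 Delta0; have aD0 := mulr_ge0 (ltW alpha0) Delta0.
have den : 0 <= specnorm (it_B it k) * (1 + alpha c * it_Delta it k).
  by rewrite mulr_ge0 ?specnorm_ge0// addr_ge0.
by rewrite /nu_bound ler_pdivrMr ?ler_peMr ?lerDl// ltr_pwDl.
Qed.

Theorem theorem3p11 (R : realType) (n : nat)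
  (f : 'cV[R]_n -> R) (h : 'cV[R]_n -> \bar R)
  (psi : 'cV[R]_n -> 'cV[R]_n -> \bar R)
  (c : tr_constants R) (it : tr_iterates R n)
  (kappa_mdc kappa_ubd mu p : R)
  (N N1 : set nat) (nubar : R) (xbar : 'cV[R]_n) (psibar : 'cV[R]_n -> \bar R)
  (f_C1 : continuously_differentiable f)
  (h_proper : proper_fun h) (h_lsc : lower_semicontinuous h)
  (psi_model : model_assumption h psi)
  (c_valid : valid_constants c)
  (run : trust_region_run f h psi c it)
  (nu_eq : forall k, it_nu it k = nu_bound c it k)
  (kappa_mdc_01 : 0 < kappa_mdc < 1)
  (model_decrease : forall k,
     (kappa_mdc%:E * xi_at f h psi it k <= predicted_decrease f psi it k)%E)
  (kappa_ubd_gt0 : 0 < kappa_ubd)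
  (model_accuracy : forall k,
     (`| objective f h (it_x it k + it_s it k)
         - m_quad f psi (it_x it k) (it_B it k) (it_s it k) |
      <= (kappa_ubd * (1 + specnorm (it_B it k)) * enorm (it_s it k) ^+ 2)%:E)%E)
  (mu_gt0 : 0 < mu) (p_01 : 0 < p < 1)
  (B_growth : forall k : nat,
     \big[Num.max/0]_(j < k.+1) specnorm (it_B it j)
       <= mu * (1 + (sigma c it k)%:R `^ p))
  (infinitely_many_successes : infinite_set [set k | successful c it k])
  (S_large : \forall eps \near 0^'+,
     ((mu + 1)%:E
        <= mu%:E * poweR (counting (successful_before f h psi c it eps)) p)%E)
  (bounded_below : exists b : R,
     forall k, (b%:E <= objective f h (it_x it k))%E)
  (N_infinite : infinite_set N)
  (criticality_cvg : criticality f h psi it @ within N \oo --> 0%E)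
  (scaled_s1_cvg :
     (fun k => (it_nu it k)^-1 *: it_s1 it k) @ within N \oo --> (0 : 'cV[R]_n))
  (s1_cvg : it_s1 it @ within N \oo --> (0 : 'cV[R]_n))
  (s_cvg : it_s it @ within N \oo --> (0 : 'cV[R]_n))
  (N1_sub : N1 `<=` N) (N1_infinite : infinite_set N1)
  (nu_cvg : it_nu it @ within N1 \oo --> nubar) (nubar_gt0 : 0 < nubar)
  (x_cvg : it_x it @ within N1 \oo --> xbar)
  (psibar_epi : is_upper_epi_limit N1 (fun k => psi (it_x it k)) psibar)
  (psibar_not_infty : exists s, psibar s != +oo%E)
  (psibar_proper : proper_fun psibar) (psibar_lsc : lower_semicontinuous psibar)
  (psibar_0 : psibar 0 = h xbar)
  (psibar_subdiff : limiting_subdiff psibar 0 `<=` limiting_subdiff h xbar)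
  (psi_s1_cvg :
     (fun k => psi (it_x it k) (it_s1 it k)) @ within N1 \oo --> psibar 0) :
  [set grad f xbar + v | v in limiting_subdiff h xbar] 0.
Proof.
have [[eta1_gt0 _ _] [_ [_ [_ [alpha_gt0 _]]]]] := c_valid.
have [kappa_mdc_gt0 _] := andP kappa_mdc_01.
have [h_fin obj_le] : (forall k, h (it_x it k) \is a fin_num) /\
    (forall k, (objective f h (it_x it k) <= objective f h (it_x it 0%N))%E).
  by split=> k; have [] := run_objective psi_model run kappa_mdc_gt0 eta1_gt0
    model_decrease model_accuracy k.
have FN1 := within_infinite_proper N1_infinite.
have s1_cvg1 := cvg_within_subset N1_sub s1_cvg.
have g_cvg : grad f (it_x it k) @[k --> within N1 \oo] --> grad f xbar.
  exact: (@continuous_cvg _ 'cV[R]_n 'cV[R]_n _ _ _ (grad f) xbar (f_C1.2 xbar)).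
have f_cvg : f (it_x it k) @[k --> within N1 \oo] --> f xbar.
  exact: (@continuous_cvg _ 'cV[R]_n R _ _ _ f xbar
    (differentiable_continuous (f_C1.1 xbar))).
have nuV_cvg : (it_nu it k)^-1 @[k --> within N1 \oo] --> nubar^-1.
  by apply: cvgV => //; rewrite gt_eqF.
(* [q k] is the real-valued part of the first-order model without the constant [f (it_x it k)]. *)
pose q k v := dot (grad f (it_x it k)) v + 2^-1 * (it_nu it k)^-1 * enorm v ^+ 2.
have q_cvg (v : nat -> 'cV[R]_n) (w : 'cV[R]_n) :
    v @ within N1 \oo --> w ->
    q k (v k) @[k --> within N1 \oo] -->
      dot (grad f xbar) w + 2^-1 * nubar^-1 * enorm w ^+ 2.
  move=> vw; apply: cvgD; first exact: cvg_dot.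
  apply: cvgM; first by apply: cvgM => //; exact: cvg_cst.
  by apply: cvgM; exact: cvg_enorm.
have q_s1_cvg : q k (it_s1 it k) @[k --> within N1 \oo] --> (0 : R).
  have := q_cvg _ _ s1_cvg1.
  by rewrite dot0r enorm0 expr0n mulr0 addr0.
have psi_s1_le k : (psi (it_x it k) (it_s1 it k) <=
    (fine (objective f h (it_x it 0%N)) - f (it_x it k)
      - q k (it_s1 it k))%:E)%E.
  have := le_trans (cp_step_le psi_model run (h_fin k)) (obj_le k).
  rewrite /m_cp /phi_cp /objective /q.
  have /EFin_fin_numP[r ->] := psi_cp_step_fin_num psi_model run (h_fin k).
  case/EFin_fin_numP: (h_fin 0%N) => r0 ->.
  by rewrite -!EFinD /= !lee_fin => *; lra.
have psibar_0_fin : psibar 0 \is a fin_num.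
  have [_ /(_ 0) psibar_gtNy] := psibar_proper.
  rewrite fin_numE gt_eqF//=; apply/negP => /eqP psibar_y.
  (* The limit of [psi_s1_le]: a convergent real upper bound keeps [psibar 0] away from [+oo]. *)
  have : (psibar 0%R <= (fine (objective f h (it_x it 0%N)) - f xbar - 0)%:E)%E.
    apply: (lee_cvg_to psi_s1_cvg); last by near=> k; exact: psi_s1_le.
    apply: cvg_EFin; first by near=> k.
    by apply: cvgB => //; apply: cvgB => //; exact: cvg_cst.
  by rewrite psibar_y.
(* Eventually [nubar / 2 < it_nu it k <= alpha c * it_Delta it k]; dividing by [alpha c] gives this
   radius. *)
pose delta := nubar / 2 / alpha c.
have delta_le : \forall k \near within N1 \oo, delta <= it_Delta it k.
  have nu_gt : \forall k \near within N1 \oo, nubar / 2 < it_nu it k.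
    by apply: cvgr_gt nu_cvg _ _; rewrite ltr_pdivrMr// ltr_pMr// ltr1n.
  apply: filterS nu_gt => k nu_gt.
  rewrite /delta ler_pdivrMr// [leRHS]mulrC.
  apply: le_trans (ltW nu_gt) _; rewrite nu_eq.
  exact: nu_bound_le (run_Delta_ge0 run k).
have psibar_ge v t : enorm v < delta -> (psibar v <= t%:E)%E ->
    (psibar 0%R <=
      (dot (grad f xbar) v + 2^-1 * nubar^-1 * enorm v ^+ 2 + t)%:E)%E.
  move=> v_delta psibar_v.
  have : epigraph psibar (t, v) by [].
  (* The recovery sequence consists of epigraph points: [(u k).2] tends to [v] and [(u k).1] bounds
     the model value there and tends to [t]. *)
  rewrite psibar_epi => -[u u_cvg u_epi].
  have t_cvg : (u k).1 @[k --> within N1 \oo] --> t.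
    exact: (cvg_comp _ _ u_cvg cvg_fst).
  have v_cvg : (u k).2 @[k --> within N1 \oo] --> v.
    exact: (cvg_comp _ _ u_cvg cvg_snd).
  (* The strict bound on [enorm v] makes the recovery points eventually feasible competitors of
     [it_s1 it k]. *)
  have v_lt : \forall k \near within N1 \oo, enorm (u k).2 < delta.
    exact: cvgr_lt (cvg_enorm v_cvg) _ v_delta.
  apply: (lee_cvg_to (g := fun k => (q k (u k).2 + (u k).1 - q k (it_s1 it k))%:E)
    psi_s1_cvg).
    apply: cvg_EFin; first by near=> k.
    rewrite -[X in _ --> X]subr0; apply: cvgB => //; apply: cvgD => //.
    exact: q_cvg.
  near=> k.
  have : (psi (it_x it k) (u k).2 <= (u k).1%:E)%E by near: k.
  have : enorm (u k).2 <= it_Delta it k.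
    by apply: (@le_trans _ _ delta); [apply: ltW|]; near: k.
  move=> /(run_s1_argmin run); rewrite /m_cp /phi_cp /q.
  have /EFin_fin_numP[r ->] := psi_cp_step_fin_num psi_model run (h_fin k).
  case: (psi (it_x it k) (u k).2) => [p'| |] //.
  by rewrite -!EFinD !lee_fin => *; lra.
exists (- grad f xbar); last by rewrite subrr.
apply/psibar_subdiff/regular_subdiff_limiting.
apply: (@quadratic_minorant_regular_subdiff _ _ _ _ _ (2^-1 * nubar^-1) delta) => //.
  by rewrite !divr_gt0.
move=> v; rewrite subr0 => vdelta.
rewrite dotNl.
(* The inequality is trivial at [+oo], and properness excludes [-oo]. At a finite value, [psibar_ge]
   applies with [t] equal to that value. *)
case psibar_v: (psibar v) => [t| |]; last 2 first.
  by rewrite leey.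
  by have := psibar_proper.2 v; rewrite psibar_v.
have := psibar_ge v t vdelta; rewrite psibar_v lexx => /(_ isT).
move: psibar_0_fin => /EFin_fin_numP[r ->]; rewrite -EFinD !lee_fin => ?; lra.
Unshelve. all: by end_near. Qed.
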